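(* Let $q\in\mathbb{C}$ with $0<|q|<1$, let $a,z\in\mathbb{C}\setminus\{0\}$ and $x=\frac12(z+z^{-1})$. Then as $n\to\infty$, $$H_n(x;a|q^{-1})\sim q^{-\binom n2}(-a)^n\left(\tfrac za,\tfrac1{az};q\right)_\infty,$$ with an error term of order $\mathcal{O}\!\left(\frac{|q|^{-\binom n2}|a|^n}{n}\right)$; that is, the difference of the two sides is $\mathcal{O}\!\left(\frac{|q|^{-\binom n2}|a|^n}{n}\right)$ as $n\to\infty$.
   Context: Notation: $(A;p)_n=\prod_{j=0}^{n-1}(1-Ap^j)$ for $p\in\mathbb{C}\setminus\{0\}$; $(A;q)_\infty=\prod_{j\ge0}(1-Aq^j)$; $(A_1,\dots,A_k;p)_n=\prod_i(A_i;p)_n$ (also $n=\infty$). $\binom n2=\frac{n(n-1)}2$. Continuous big Hermite polynomials: for a base $p\in\mathbb{C}\setminus\{0\}$, $|p|\ne1$, $x=\frac12(z+z^{-1})$, $$H_n(x;a|p)=a^{-n}\sum_{k=0}^n\frac{(p^{-n},az,az^{-1};p)_k}{(p;p)_k}\,p^k .$$ The continuous big $q^{-1}$-Hermite polynomials are $H_n(x;a|q^{-1})$, i.e. $p=q^{-1}$. *)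

(* Defs.v *)
From HB Require Import structures.
From mathcomp Require Import all_boot all_order all_algebra.
From mathcomp Require Import all_classical all_reals all_analysis.
From mathcomp Require Export complex.
From mathcomp Require Import ring.

Set Implicit Arguments.
Unset Strict Implicit.
Unset Printing Implicit Defensive.

Import Order.TTheory GRing.Theory Num.Theory.
Import numFieldNormedType.Exports.

Local Open Scope classical_set_scope.
Local Open Scope ring_scope.

(* The topology of R[i] is the one of its modulus, as for any numFieldType;
   the instance lets limits and O(.) apply to the concrete type R[i]. *)
HB.instance Definition _ (R : rcfType) :=
  NormedModule.copy R[i] (R[i] : numFieldType)^o.

Section Defs.
Variable R : realType.
Implicit Types (A p q x z a : R[i]) (n k : nat).

Definition qpoch A p n : R[i] := \prod_(0 <= j < n) (1 - A * p ^+ j).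

Definition qpoch_inf A q : R[i] := lim (qpoch A q n @[n --> \oo]).

Definition big_qHermite_z n z a p : R[i] :=
  a ^- n * \sum_(0 <= k < n.+1)
    (qpoch (p ^- n) p k * qpoch (a * z) p k * qpoch (a * z^-1) p k
       / qpoch p p k) * p ^+ k.

(* H_n(x; a | p) as a function of x: z is taken to be a root of
   x = (z + z^-1) / 2, namely x + sqrt (x^2 - 1).  The other root is z^-1 and
   the choice is immaterial, see [big_qHermiteE]. *)
Definition big_qHermite n x a p : R[i] :=
  big_qHermite_z n (x + sqrtc (x ^+ 2 - 1)) a p.

Lemma big_qHermite_zV n z a p : big_qHermite_z n z^-1 a p = big_qHermite_z n z a p.
Proof.
rewrite /big_qHermite_z invrK; congr (_ * _).
by apply: eq_bigr => k _; congr (_ / _ * _); rewrite mulrAC.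
Qed.

Lemma big_qHermiteE n z a p : z != 0 ->
  big_qHermite n ((z + z^-1) / 2) a p = big_qHermite_z n z a p.
Proof.
move=> z0; rewrite /big_qHermite; set x := (z + z^-1) / 2.
have := sqr_sqrtc (x ^+ 2 - 1); set s := sqrtc _ => sE.
have : (s - (z - z^-1) / 2) * (s + (z - z^-1) / 2) = 0.
  by rewrite -subr_sqr sE /x; field; rewrite z0.
move=> /eqP; rewrite mulf_eq0 => /orP[/eqP/subr0_eq ->|].
  by congr (big_qHermite_z _ _ _ _); rewrite /x; field; rewrite z0.
rewrite addr_eq0 => /eqP ->; rewrite -[RHS]big_qHermite_zV.
by congr (big_qHermite_z _ _ _ _); rewrite /x; field; rewrite z0.
Qed.

End Defs.

(* Main.v *)
Require Import Defs.
From mathcomp Require Import all_boot all_order all_algebra.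
From mathcomp Require Import all_classical all_reals all_analysis.
From mathcomp Require Import ring lra.

Import Order.TTheory GRing.Theory Num.Theory.
Import numFieldNormedType.Exports.

Local Open Scope classical_set_scope.
Local Open Scope ring_scope.

(** In base 1/q every shifted factorial turns into one in base q, since
    1 - A q^-j = - A q^-j (1 - q^j / A).  Doing this in each term gives
      H_n = a^-n sum_(k <= n) [n, k]_q (- a^2)^k q^(- C(k, 2)) P_k,
      P_k = (z/a, 1/(az); q)_k,
    where [n, k]_q is the Gaussian binomial coefficient
    ([big_qHermite_z_invbase]).  The factor q^(- C(k, 2)) makes the last term
    k = n dominate.  Dividing by q^(- C(n, 2)) (-a)^n
    ([big_qHermite_z_normalized]) leaves
      P_n + sum_(k < n) [n, k]_q (- a^-2)^(n - k) q^(C(n, 2) - C(k, 2)) P_k.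

    Two estimates finish the proof, with r = |q|:
    - P_n tends to its infinite product with error O(r^n), because its
      increments are O(r^n) ([qpoch_inf_error]);
    - as [n, k]_q and P_k are bounded ([qbinom_bounded], [qpoch_bounded]), the
      remaining sum is at most a constant times
      E_n = sum_(k < n) c^(n - k) r^(C(n, 2) - C(k, 2)), c = |a|^-2, and the
      recurrence E_(n+1) = c r^n (1 + E_n) shows that E_n = O(r^n)
      ([theta_tail_le_geometric]).

    So the relative error is in fact exponentially small, O(r^n)
    ([big_qHermite_z_error]); the rate 1/n of the theorem follows because
    n r^n is bounded.

    All boundedness statements rest on
    prod_(j < n) (1 + x r^j) <= exp (x / (1 - r)).  Bounds are stated as
    elements of R[i], whose order compares numbers with equal imaginary
    parts, so that they can be used directly with the modulus. *)

(** * Geometric sequences over ordered fields and the reals *)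

(** Bernoulli's inequality for (1 + h)^n, with 1 + h = 1/r. *)
Lemma natr_mul_expr_le (K : numFieldType) (r : K) n : 0 < r -> r < 1 ->
  n%:R * r ^+ n <= (r^-1 - 1)^-1.
Proof.
move=> r0 r1; have h0 : 0 < r^-1 - 1 by rewrite subr_gt0 invf_gt1.
have bern : 1 + n%:R * (r^-1 - 1) <= (r^-1) ^+ n.
  elim: n => [|n IH]; first by rewrite mul0r addr0 expr0.
  rewrite exprSr; apply: le_trans (ler_wpM2r _ IH); last by rewrite invr_ge0 ltW.
  rewrite -subr_ge0 -natr1.
  have -> : (1 + n%:R * (r^-1 - 1)) / r - (1 + (n%:R + 1) * (r^-1 - 1))
     = n%:R * (r^-1 - 1) ^+ 2 by ring.
  by rewrite mulr_ge0 // exprn_ge0 // ltW.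
rewrite -[leRHS]mul1r ler_pdivlMr // mulrAC -ler_pdivlMr ?exprn_gt0 //.
by rewrite mul1r -exprVn; apply: le_trans bern; rewrite lerDr.
Qed.

(** From 1 + t <= exp t and the sum of the geometric series. *)
Lemma prod_geometric_le (R : realType) (x r : R) n : 0 <= x -> 0 < r -> r < 1 ->
  \prod_(0 <= j < n) (1 + x * r ^+ j) <= expR (x / (1 - r)).
Proof.
move=> x0 r0 r1.
apply: (@le_trans _ _ (expR (\sum_(0 <= j < n) x * r ^+ j))).
  rewrite expR_sum; apply: ler_prod => j _; rewrite expR_ge1Dx andbT.
  by rewrite addr_ge0 // mulr_ge0 // exprn_ge0 // ltW.
rewrite ler_expR.
by apply: geometric_le_lim; rewrite // ger0_norm // ltW.
Qed.

(** Adding and subtracting the tail c r^n / (1 - r) of the increments encloses v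
    between a nondecreasing and a nonincreasing sequence; the limit is the
    supremum of the lower one, and the width of the enclosure is the rate. *)
Lemma geometric_increments_limit (R : realType) (v : nat -> R) (c r : R) :
  0 <= c -> 0 < r -> r < 1 ->
  (forall n, `|v n.+1 - v n| <= c * r ^+ n) ->
  exists l, forall n, `|v n - l| <= c / (1 - r) * r ^+ n.
Proof.
move=> c0 r0 r1 dv; set d := c / (1 - r).
have d0 : 0 <= d by rewrite divr_ge0 // subr_ge0 ltW.
have rn n : 0 <= r ^+ n by rewrite exprn_ge0 // ltW.
have dE n : d * r ^+ n - d * r ^+ n.+1 = c * r ^+ n.
  by rewrite /d exprS; field; rewrite subr_eq0 gt_eqF.
have wincr : nondecreasing_seq (fun n => v n - d * r ^+ n).
  apply/nondecreasing_seqP => n.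
  by have := dv n; have := dE n; rewrite ler_norml => E /andP[]; lra.
have tdecr : nonincreasing_seq (fun n => v n + d * r ^+ n).
  apply/nonincreasing_seqP => n.
  by have := dv n; have := dE n; rewrite ler_norml => E /andP[]; lra.
have wt m n : v m - d * r ^+ m <= v n + d * r ^+ n.
  apply: le_trans (wincr _ _ (leq_maxl m n)) _.
  apply: le_trans (tdecr _ _ (leq_maxr m n)).
  by rewrite lerD2l ge0_cp // mulr_ge0.
pose S := range (fun n => v n - d * r ^+ n).
have S0 : S !=set0 by exists (v 0%N - d * r ^+ 0), 0%N.
exists (sup S) => n.
have lo : v n - d * r ^+ n <= sup S.
  apply: ub_le_sup; last by exists n.
  by exists (v 0%N + d * r ^+ 0) => _ [m _ <-].
have hi : sup S <= v n + d * r ^+ n by apply: ge_sup => // _ [m _ <-].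
by rewrite ler_distl; apply/andP; split; lra.
Qed.

(** * Bounds and limits of complex sequences *)

Section ComplexBase.
Variable R : realType.
Implicit Types (A q z a : R[i]).

Lemma prod_geometric_bounded (x r : R[i]) : 0 <= x -> 0 < r -> r < 1 ->
  exists B : R[i], forall n, \prod_(0 <= j < n) (1 + x * r ^+ j) <= B.
Proof.
move=> x0 r0 r1.
have /complex_realP[y yE] := ger0_real x0.
have /complex_realP[s sE] := gtr0_real r0.
move: x0 r0 r1; rewrite {}yE {}sE ler0c ltcR -[1]/(1%:C)%C ltcR => y0 s0 s1.
exists (expR (y / (1 - s)))%:C%C => n.
under eq_bigr do rewrite -rmorphXn -rmorphM -rmorphD.
by rewrite -rmorph_prod lecR prod_geometric_le.
Qed.

Lemma le_norm_ReIm z : `|z| <= `|complex.Re z|%:C%C + `|complex.Im z|%:C%C.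
Proof.
rewrite normc_def -rmorphD lecR -[leRHS]ger0_norm ?addr_ge0 // -sqrtr_sqr.
rewrite ler_wsqrtr // sqrrD !real_normK ?num_real // -addrA lerD2l lerDr.
by rewrite mulrn_wge0 // mulr_ge0.
Qed.

Lemma normc_ge_Im z : `|complex.Im z|%:C%C <= `|z|.
Proof.
by rewrite normc_def lecR -sqrtr_sqr ler_wsqrtr // lerDr sqr_ge0.
Qed.

(** The real case applied to the real and imaginary parts.  It provides both the
    existence of the limit, which the limit operator needs to be meaningful, and
    the rate of convergence. *)
Lemma cvg_geometric_increments (u : nat -> R[i]) (c r : R[i]) :
  0 <= c -> 0 < r -> r < 1 ->
  (forall n, `|u n.+1 - u n| <= c * r ^+ n) ->
  exists2 l, u n @[n --> \oo] --> l &
    exists C, forall n, `|u n - l| <= C * r ^+ n.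
Proof.
move=> x0 r0 r1.
have /complex_realP[y yE] := ger0_real x0.
have /complex_realP[s sE] := gtr0_real r0.
move: x0 r0 r1; rewrite {}yE {}sE ler0c ltcR -[1]/(1%:C)%C ltcR => y0 s0 s1 du.
have dre n : `|complex.Re (u n.+1) - complex.Re (u n)| <= y * s ^+ n.
  rewrite -lecR rmorphM rmorphXn; apply: le_trans (du n).
  by apply: le_trans (normc_ge_Re _); rewrite -raddfB.
have dim n : `|complex.Im (u n.+1) - complex.Im (u n)| <= y * s ^+ n.
  rewrite -lecR rmorphM rmorphXn; apply: le_trans (du n).
  by apply: le_trans (normc_ge_Im _); rewrite -raddfB.
have [a ha] := @geometric_increments_limit R _ _ _ y0 s0 s1 dre.
have [b hb] := @geometric_increments_limit R _ _ _ y0 s0 s1 dim.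
set d := y / (1 - s) in ha hb.
have ul n : `|u n - (a +i* b)%C| <= ((d + d) * s ^+ n)%:C%C.
  apply: le_trans (le_norm_ReIm _) _.
  rewrite -rmorphD lecR mulrDl; move: (ha n) (hb n).
  by case: (u n) => ? ? /=; exact: lerD.
exists (a +i* b)%C; last first.
  by exists (d + d)%:C%C => n; rewrite -rmorphXn -rmorphM.
apply/cvgrPdist_le => e e0.
have /complex_realP[k kE] := gtr0_real e0.
move: e0; rewrite {}kE ltcR => k0.
have s1' : `|s| < 1 by rewrite ger0_norm // ltW.
have /cvgrPdist_le/(_ _ k0) := @cvg_geometric R (d + d) s s1'.
apply: filterS => n; rewrite sub0r normrN => h.
rewrite distrC; apply: le_trans (ul n) _; rewrite lecR.
exact: le_trans (ler_norm _) h.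
Qed.

(** * Changing the base from 1/q to q *)

Lemma qpoch0 A q : qpoch A q 0 = 1.
Proof. by rewrite /qpoch big_geq. Qed.

Lemma qpochS A q n : qpoch A q n.+1 = qpoch A q n * (1 - A * q ^+ n).
Proof. by rewrite /qpoch big_nat_recr. Qed.

(** 1 - A q^-j = (- A) q^-j (1 - A^-1 q^j), and the exponents j < n add up to
    C(n, 2). *)
Lemma qpoch_invbase A q n : A != 0 -> q != 0 ->
  qpoch A q^-1 n = (- A) ^+ n * q ^- 'C(n, 2) * qpoch A^-1 q n.
Proof.
move=> A0 q0; elim: n => [|n IH]; first by rewrite !qpoch0 bin0n invr1 !mulr1.
rewrite !qpochS IH binS bin1 exprD exprS exprVn.
by field; rewrite A0 !expf_neq0.
Qed.

(** The factors 1 - q^(n - j), j < k, are the last k factors of (q; q)_n. *)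
Lemma qpoch_expr_invbase q n k : q != 0 -> (k <= n)%N ->
  qpoch (q ^+ n) q^-1 k * qpoch q q (n - k) = qpoch q q n.
Proof.
move=> q0; elim: k => [|k IH] kn; first by rewrite qpoch0 mul1r subn0.
rewrite -IH ?(ltnW kn) // -[in RHS](subnSK kn) !qpochS -exprS subnSK //.
rewrite (expfB _ kn) -exprVn.
by rewrite mulrAC mulrA.
Qed.

(** The Gaussian binomial coefficient. *)
Definition qbinom q n k : R[i] :=
  qpoch q q n / (qpoch q q (n - k) * qpoch q q k).

Lemma qpoch_self_neq0 q n : `|q| < 1 -> qpoch q q n != 0.
Proof.
move=> q1; elim: n => [|n IH]; first by rewrite qpoch0 oner_neq0.
rewrite qpochS mulf_neq0 // -exprS subr_eq0; apply/eqP => /esym E.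
have := exprn_ilt1 n.+1 (normr_ge0 q) q1.
by rewrite -normrX E normr1 ltxx.
Qed.

Lemma big_qHermite_z_invbase q n a z : q != 0 -> `|q| < 1 -> a != 0 -> z != 0 ->
  big_qHermite_z n z a q^-1 =
  a ^- n * \sum_(0 <= k < n.+1) qbinom q n k * (- a ^+ 2) ^+ k * q ^- 'C(k, 2)
     * (qpoch (z / a) q k * qpoch (a * z)^-1 q k).
Proof.
move=> q0 q1 a0 z0; congr (_ * _); apply: eq_big_nat => k /andP[_ kn].
rewrite ltnS in kn.
have E := @qpoch_expr_invbase q n k q0 kn.
rewrite [X in qpoch X](_ : q^-1 ^- n = q ^+ n); last by rewrite exprVn invrK.
rewrite /qbinom -{}E; set Q := qpoch (q ^+ n) q^-1 k.
rewrite ![qpoch _ q^-1 _]qpoch_invbase ?mulf_neq0 ?invr_eq0 ?expf_neq0 //.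
have qn j : qpoch q q j != 0 by exact: qpoch_self_neq0.
have -> : (a * z^-1)^-1 = z / a by field; rewrite a0 z0.
rewrite invrK.
rewrite -[- (a * z)]mulN1r -[- (a * z^-1)]mulN1r -[- (q^-1)]mulN1r.
rewrite -[- (a ^+ 2)]mulN1r !exprMn !exprVn.
by field; rewrite !qn !expf_neq0 // oppr_eq0 oner_eq0.
Qed.

(** Measures the weight of the k-th term against that of the n-th one.  The
    exponent C(n, 2) - C(k, 2) is a natural number as k <= n, and for |q| < 1
    this makes the earlier terms small compared with the last one. *)
Lemma reversed_weight q a n k : q != 0 -> a != 0 -> (k <= n)%N ->
  a ^- n * ((- a ^+ 2) ^+ k * q ^- 'C(k, 2)) =
  q ^- 'C(n, 2) * (- a) ^+ n
    * ((- a ^- 2) ^+ (n - k) * q ^+ ('C(n, 2) - 'C(k, 2))).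
Proof.
move=> q0 a0 kn; have := subnK (leq_bin2l 2 kn).
move: ('C(n, 2) - 'C(k, 2))%N => d <-.
rewrite -(subnK kn) addnK; move: (n - k)%N => m.
have -> : (- a) ^+ (m + k) = (- a) ^+ m * (- a) ^+ k by rewrite exprD.
have E : (- a) ^+ m * (- a ^- 2) ^+ m = a ^- m.
  rewrite -exprMn; have -> : - a * - a ^- 2 = a^-1 by field.
  exact: exprVn.
have -> : - a ^+ 2 = a * - a by ring.
rewrite exprMn !exprD.
transitivity (a ^- m * (- a) ^+ k * q ^- 'C(k, 2)).
  by field; rewrite !expf_neq0.
by rewrite -E; field; rewrite !expf_neq0.
Qed.

Lemma big_qHermite_z_normalized q n a z :
  q != 0 -> `|q| < 1 -> a != 0 -> z != 0 ->
  big_qHermite_z n z a q^-1 =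
  q ^- 'C(n, 2) * (- a) ^+ n * \sum_(0 <= k < n.+1)
    qbinom q n k * ((- a ^- 2) ^+ (n - k) * q ^+ ('C(n, 2) - 'C(k, 2)))
     * (qpoch (z / a) q k * qpoch (a * z)^-1 q k).
Proof.
move=> q0 q1 a0 z0; rewrite big_qHermite_z_invbase // !mulr_sumr.
apply: eq_big_nat => k /andP[_ kn].
set P := _ * qpoch _ _ k; have := @reversed_weight q a n k q0 a0 kn.
set W := _ * q ^+ (_ - _) => E.
rewrite [RHS]mulrA [X in _ = X * P]mulrCA -E; ring.
Qed.

(** * Estimates for |q| < 1 *)

Section Estimates.
Variable q : R[i].
Hypotheses (q0 : 0 < `|q|) (q1 : `|q| < 1).

Lemma qpoch_bounded A : exists B : R[i], forall n, `|qpoch A q n| <= B.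
Proof.
have [B HB] := @prod_geometric_bounded `|A| `|q| (normr_ge0 A) q0 q1.
exists B => n; apply: le_trans (HB n); rewrite normr_prod.
apply: ler_prod => j _; rewrite normr_ge0 /=.
by apply: le_trans (ler_normB _ _) _; rewrite normr1 normrM normrX.
Qed.

(** Each factor satisfies
      |1 - q^(j+1)|^-1 <= 1 / (1 - r^(j+1)) = 1 + r^(j+1) / (1 - r^(j+1))
                       <= 1 + (r / (1 - r)) r^j    with r = |q|,
    so the product is again of the form prod (1 + x r^j). *)
Lemma inv_qpoch_self_bounded :
  exists B : R[i], forall n, `|(qpoch q q n)^-1| <= B.
Proof.
have d0 : 0 < 1 - `|q| by rewrite subr_gt0.
have x0 : 0 <= `|q| / (1 - `|q|) by rewrite divr_ge0 // ltW.
have [B HB] := @prod_geometric_bounded _ `|q| x0 q0 q1.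
exists B => n; apply: le_trans (HB n); rewrite /qpoch -prodfV normr_prod.
apply: ler_prod => j _; rewrite normr_ge0 /= normfV.
have le_q : `|q| ^+ j.+1 <= `|q| by rewrite exprS ger_pMr // exprn_ile1 // ltW.
have dj : 1 - `|q| <= 1 - `|q| ^+ j.+1 by rewrite lerD2l lerN2.
have dj0 : 0 < 1 - `|q| ^+ j.+1 by exact: lt_le_trans dj.
apply: (@le_trans _ _ (1 - `|q| ^+ j.+1)^-1).
  have lo : 1 - `|q| ^+ j.+1 <= `|1 - q * q ^+ j|.
    by rewrite -exprS -normrX -[X in X - _](normr1 R[i]) lerB_dist.
  by rewrite lef_pV2 ?posrE // (lt_le_trans dj0).
have -> : (1 - `|q| ^+ j.+1)^-1 = 1 + `|q| ^+ j.+1 / (1 - `|q| ^+ j.+1).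
  by field; rewrite gt_eqF.
by rewrite lerD2l mulrAC -exprS ler_wpM2l ?exprn_ge0 // lef_pV2 ?posrE.
Qed.

Lemma qbinom_bounded : exists B : R[i], forall n k, `|qbinom q n k| <= B.
Proof.
have [B HB] := qpoch_bounded q; have [D HD] := inv_qpoch_self_bounded.
exists (B * (D * D)) => n k; rewrite /qbinom invfM !normrM.
by rewrite !ler_pM ?mulr_ge0 ?normr_ge0.
Qed.

(** The increment (A; q)_(n+1) - (A; q)_n = - (A; q)_n A q^n is geometrically
    small because (A; q)_n is bounded. *)
Lemma qpoch_inf_error A :
  exists C : R[i], forall n, `|qpoch A q n - qpoch_inf A q| <= C * `|q| ^+ n.
Proof.
have [B HB] := qpoch_bounded A.
have B0 : 0 <= B by exact: le_trans (HB 0%N).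
have incr n : `|qpoch A q n.+1 - qpoch A q n| <= B * `|A| * `|q| ^+ n.
  rewrite qpochS mulrBr mulr1 addrAC subrr sub0r normrN !normrM normrX mulrA.
  by rewrite !ler_wpM2r ?exprn_ge0.
have [l ul [C HC]] :=
  @cvg_geometric_increments _ _ `|q| (mulr_ge0 B0 (normr_ge0 A)) q0 q1 incr.
exists C => n; suff -> : qpoch_inf A q = l by [].
exact: (cvg_lim (@norm_hausdorff _ _) ul).
Qed.

Lemma qpoch_pair_inf_error A A' : exists C : R[i], forall n,
  `|qpoch A q n * qpoch A' q n - qpoch_inf A q * qpoch_inf A' q|
    <= C * `|q| ^+ n.
Proof.
have [C HC] := qpoch_inf_error A; have [C' HC'] := qpoch_inf_error A'.
have [B HB] := qpoch_bounded A'.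
exists (C * B + `|qpoch_inf A q| * C') => n.
set X := qpoch A q n in HC *; set Y := qpoch A' q n; set L := qpoch_inf A q.
have -> : X * Y - L * qpoch_inf A' q
  = (X - L) * Y + L * (Y - qpoch_inf A' q) by ring.
apply: le_trans (ler_normD _ _) _; rewrite !normrM mulrDl.
apply: lerD; last by rewrite -mulrA ler_wpM2l // HC'.
by rewrite mulrAC; apply: ler_pM => //; [exact: HC|exact: HB].
Qed.

(** With E_n the sum, C(n+1, 2) = C(n, 2) + n gives
    E_(n+1) = c |q|^n (1 + E_n).  Hence 1 + E_n is at most
    prod_(j < n) (1 + c |q|^j), which is bounded, and the recurrence turns this
    bound into the geometric one. *)
Lemma theta_tail_le_geometric (c : R[i]) : 0 <= c -> exists C : R[i], forall n,
  \sum_(0 <= k < n) c ^+ (n - k) * `|q| ^+ ('C(n, 2) - 'C(k, 2)) <= C * `|q| ^+ n.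
Proof.
move=> c0; pose E n := \sum_(0 <= k < n) c ^+ (n - k) * `|q| ^+ ('C(n, 2) - 'C(k, 2)).
have ES n : E n.+1 = c * `|q| ^+ n * (1 + E n).
  rewrite /E big_nat_recr //= subSnn expr1 binS bin1 addKn addrC mulrDr mulr1.
  congr (_ + _); rewrite mulr_sumr; apply: eq_big_nat => k /andP[_ kn].
  rewrite subSn ?(ltnW kn) // exprS addnC.
  rewrite -addnBA ?leq_bin2l ?(ltnW kn) // exprD; ring.
have E0 : E 0%N = 0 by rewrite /E big_geq.
have [B HB] := @prod_geometric_bounded c `|q| c0 q0 q1.
have qn n : 0 <= `|q| ^+ n by rewrite exprn_ge0.
have Ege n : 0 <= E n.
  by rewrite sumr_ge0 // => k _; rewrite mulr_ge0 ?exprn_ge0.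
have EB n : 1 + E n <= B.
  apply: le_trans (HB n); elim: n => [|n IH].
    by rewrite E0 addr0 big_geq.
  rewrite big_nat_recr //= ES.
  apply: (@le_trans _ _ ((1 + E n) * (1 + c * `|q| ^+ n))).
    by rewrite [leRHS]mulrDr mulr1 -addrA lerD2l mulrC lerDr.
  by rewrite ler_wpM2r // addr_ge0 // mulr_ge0.
(* Division by |q| compensates for the recurrence bounding E_(n+1) by |q|^n. *)
exists (c * B / `|q|) => -[|n].
  rewrite -/(E 0%N) E0 expr0 mulr1 divr_ge0 // mulr_ge0 //.
  by apply: le_trans (EB 0%N); rewrite E0 addr0.
rewrite -/(E n.+1) ES exprS mulrA divfK ?gt_eqF //.
by rewrite mulrAC ler_wpM2r // ler_wpM2l.
Qed.

(** The relative error splits into the convergence error of the product P_n and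
    the sum over k < n of the dominated terms; both are O(|q|^n). *)
Lemma big_qHermite_z_error a z : a != 0 -> z != 0 -> exists C : R[i], forall n,
  `|big_qHermite_z n z a q^-1
    - q ^- 'C(n, 2) * (- a) ^+ n
      * (qpoch_inf (z / a) q * qpoch_inf (a * z)^-1 q)|
  <= `|q| ^- 'C(n, 2) * `|a| ^+ n * (C * `|q| ^+ n).
Proof.
move=> a0 z0; have qn0 : q != 0 by rewrite -normr_gt0.
set A := z / a; set A' := (a * z)^-1.
have [C HC] := qpoch_pair_inf_error A A'.
have [M HM] := qbinom_bounded.
have [B HB] := qpoch_bounded A; have [B' HB'] := qpoch_bounded A'.
pose c := `|a| ^- 2; have c0 : 0 <= c by rewrite invr_ge0 exprn_ge0.
have [D HD] := theta_tail_le_geometric _ c0.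
have M0 : 0 <= M by exact: le_trans (HM 0%N 0%N).
have BB0 : 0 <= B * B'.
  by apply: mulr_ge0; [exact: le_trans (HB 0%N)|exact: le_trans (HB' 0%N)].
exists (C + M * (B * B') * D) => n.
rewrite big_qHermite_z_normalized // big_nat_recr //= -mulrBr.
have -> : qbinom q n n = 1.
  by rewrite /qbinom subnn qpoch0 mul1r divff // qpoch_self_neq0.
rewrite !subnn !expr0 !mul1r -addrA addrC.
rewrite !normrM normfV !normrX normrN ler_wpM2l ?mulr_ge0 ?invr_ge0 ?exprn_ge0 //.
rewrite [leRHS]mulrDl; apply: le_trans (ler_normD _ _) _.
apply: lerD; first exact: HC.
apply: le_trans (ler_norm_sum _ _ _) _; rewrite -mulrA.
apply: le_trans (ler_wpM2l _ (HD n)); last by rewrite mulr_ge0.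
rewrite mulr_sumr; apply: ler_sum => k _.
move: (qbinom q n k) (HM n k) => b bM.
rewrite !normrM !normrX normrN normfV normrX -/c [leRHS]mulrAC.
rewrite ler_pM ?mulr_ge0 ?exprn_ge0 //; last exact: ler_pM.
by rewrite ler_wpM2r // mulr_ge0 ?exprn_ge0.
Qed.

End Estimates.

End ComplexBase.

(** * The asymptotic formula *)

Theorem lemma4p26 (R : realType) (q a z x : R[i])
    (hq0 : 0 < `|q|) (hq1 : `|q| < 1) (ha : a != 0) (hz : z != 0)
    (hx : x = (z + z^-1) / 2) :
  (fun n : nat =>
     (big_qHermite n x a q^-1
      - q ^- 'C(n, 2) * (- a) ^+ n
        * (qpoch_inf (z / a) q * qpoch_inf (1 / (a * z)) q))%R)
  =O_\oo (fun n : nat => (`|q| ^- 'C(n, 2) * `|a| ^+ n / n%:R)%R).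
Proof.
have [C HC] := @big_qHermite_z_error R q hq0 hq1 a z ha hz.
have h0 : 0 < `|q|^-1 - 1 by rewrite subr_gt0 invf_gt1.
have C0 : 0 <= C.
  have := le_trans (normr_ge0 _) (HC 0%N).
  by rewrite bin0n invr1 !expr0 !mul1r mulr1.
(* C / (1/|q| - 1) bounds C n |q|^n; adding 1 makes the constant positive. *)
apply/eqO_exP; exists (C * (`|q|^-1 - 1)^-1 + 1).
  by rewrite ltr_wpDl // mulr_ge0 // invr_ge0 ltW.
exists 1%N => // n /= n1; have n0 : 0 < n%:R :> R[i] by rewrite ltr0n.
have w0 : 0 <= `|q| ^- 'C(n, 2) * `|a| ^+ n by rewrite mulr_ge0 ?invr_ge0 ?exprn_ge0.
rewrite hx big_qHermiteE // div1r; apply: le_trans (HC n) _.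
rewrite [`|_ / n%:R|]ger0_norm; last by rewrite divr_ge0.
rewrite [leRHS]mulrCA ler_wpM2l // ler_pdivlMr // mulrAC -mulrA.
apply: (@le_trans _ _ (C * (`|q|^-1 - 1)^-1)); last by rewrite lerDl.
by rewrite ler_wpM2l // natr_mul_expr_le.
Qed.
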